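(* Let $\mathbf{Z}=\mathbf{Z}_{\bar 0}\oplus\mathbf{Z}_{\bar 1}$ be an $n$-dimensional complex null-filiform Zinbiel superalgebra with $\dim(\mathbf{Z}_{\bar 1})\neq 0$. Then either $\dim(\mathbf{Z}_{\bar 0})=\dim(\mathbf{Z}_{\bar 1})$ or $\dim(\mathbf{Z}_{\bar 1})=\dim(\mathbf{Z}_{\bar 0})+1$, and $\mathbf{Z}$ is isomorphic to the superalgebra with basis $e_1,\dots,e_n$, where the vectors $e_{2k}$ with even index are even and the vectors $e_{2k+1}$ with odd index are odd, and with multiplication $$e_{2k+1}e_{2l}=\binom{k+l}{k}e_{2k+2l+1}\quad (k\ge 0,\ l\ge 1),$$ $$e_{2k}e_{2l}=\binom{k+l-1}{l}e_{2k+2l}\quad (k\ge 1,\ l\ge 1),$$ $$e_{2k+1}e_{2l+1}=\binom{k+l}{l}e_{2k+2l+2}\quad (k\ge 0,\ l\ge 0),$$ where $e_j:=0$ for $j>n$ and all products of basis vectors not listed (namely $e_{2k}e_{2l+1}$) are zero.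
   Context: A Zinbiel superalgebra is a $\mathbb{Z}_2$-graded vector space $\mathbf{Z}=\mathbf{Z}_{\bar 0}\oplus\mathbf{Z}_{\bar 1}$ with a bilinear product satisfying $\mathbf{Z}_i\mathbf{Z}_j\subset\mathbf{Z}_{i+j}$ and, for all homogeneous $x,y,z$, $$(xy)z=x\big(yz+(-1)^{|y||z|}zy\big).$$ Put $\mathbf{Z}^1=\mathbf{Z}$ and $\mathbf{Z}^{k+1}=\mathbf{Z}\,\mathbf{Z}^k$ (linear span of products). An $n$-dimensional Zinbiel superalgebra is called null-filiform if $\dim\mathbf{Z}^i=n+1-i$ for $1\le i\le n+1$. Isomorphisms of superalgebras preserve the $\mathbb{Z}_2$-grading. *)

(* Defs.v *)
From HB Require Import structures.
From mathcomp Require Import all_boot all_order all_algebra.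
From mathcomp Require Import sesquilinear.
From mathcomp Require Export reals complex.

Set Implicit Arguments.
Unset Strict Implicit.
Unset Printing Implicit Defensive.

Import GRing.Theory.
Local Open Scope ring_scope.

(* The degrees Z/2 are encoded by bool: false is 0, true is 1, and addition is
   the exclusive or (+). *)
Record superalgebra (F : fieldType) := Superalgebra {
  supersort :> vectType F;
  part : bool -> {vspace supersort};
  smul : {bilinear supersort -> supersort -> supersort};
  part_full : (part false + part true)%VS = fullv;
  part_direct : (part false :&: part true)%VS = 0%VS;
  smul_graded : forall (i j : bool) (x y : supersort),
    x \in part i -> y \in part j -> smul x y \in part (i (+) j)
}.

Section Superalgebra.
Variable F : fieldType.
Implicit Types A B : superalgebra F.

Definition zinbiel A : Prop :=
  forall (i j k : bool) (x y z : A),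
    x \in part A i -> y \in part A j -> z \in part A k ->
    smul A (smul A x y) z =
    smul A x (smul A y z + (-1) ^+ (j && k) *: smul A z y).

(* The span of the products of two bases, as for prodv in falgebra; see
   smulv_subvP for the span of all products. *)
Definition smulv A (U V : {vspace A}) : {vspace A} :=
  <<[seq smul A u v | u <- vbasis U, v <- vbasis V]>>%VS.

Lemma smulv_subvP A (U V W : {vspace A}) :
  reflect (forall u v, u \in U -> v \in V -> smul A u v \in W)
          (smulv U V <= W)%VS.
Proof.
apply: (iffP span_subvP) => [sUVW u v Uu Vv | sUVW w].
  rewrite (coord_vbasis Uu) (coord_vbasis Vv) linear_sumlz rpred_sum // => i _.
  rewrite linear_sumr rpred_sum // => j _.
  rewrite linearZl_LR linearZr_LR !rpredZ //; apply: sUVW.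
  by apply/allpairsP; exists ((vbasis U)`_i, (vbasis V)`_j);
     rewrite !memt_nth.
by case/allpairsP=> -[u v] /= [/vbasis_mem Uu /vbasis_mem Vv ->]; apply: sUVW.
Qed.

(* Z^k for k >= 1; the value at k = 0 is irrelevant. *)
Definition spow A (k : nat) : {vspace A} := iter k.-1 (smulv fullv) fullv.

Definition null_filiform (n : nat) A : Prop :=
  \dim {:A} = n /\
  forall i : nat, (1 <= i <= n.+1)%N -> \dim (spow A i) = (n.+1 - i)%N.

Definition superisomorphic A B : Prop :=
  exists f : 'Hom(A, B),
    [/\ bijective f,
        forall x y : A, f (smul A x y) = smul B (f x) (f y)
      & forall i : bool, (f @: part A i)%VS = part B i].

End Superalgebra.

Section Model.
Variables (F : fieldType) (n : nat).

(* Numbered from 1: the j-th unit vector if 1 <= j <= n, and 0 otherwise. *)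
Definition nf_e (j : nat) : 'rV[F]_n := \row_(i < n) (i.+1 == j)%:R.

(* With k = p./2 and l = q./2, the product of e_p and e_q. *)
Definition nf_table (p q : nat) : 'rV[F]_n :=
  let k := p./2 in
  let l := q./2 in
  match odd p, odd q with
  | true, false => 'C(k + l, k)%:R *: nf_e (2 * k + 2 * l + 1)
  | false, false => 'C(k + l - 1, l)%:R *: nf_e (2 * k + 2 * l)
  | true, true => 'C(k + l, l)%:R *: nf_e (2 * k + 2 * l + 2)
  | false, true => 0
  end.

Definition nf_mul (x y : 'rV[F]_n) : 'rV[F]_n :=
  \sum_(i < n) \sum_(j < n) (x 0 i * y 0 j) *: nf_table i.+1 j.+1.

Definition nf_part (b : bool) : {vspace 'rV[F]_n} :=
  <<[seq nf_e j | j <- iota 1 n & odd j == b]>>%VS.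

Lemma nf_mul_bilinear : bilinear_for *:%R *:%R nf_mul.
Proof.
split=> [y a u v | x a u v]; rewrite /nf_mul /= scaler_sumr -big_split /=.
  apply: eq_bigr => i _; rewrite scaler_sumr -big_split /=.
  by apply: eq_bigr => j _; rewrite !mxE scalerA -scalerDl mulrDl mulrA.
apply: eq_bigr => i _; rewrite scaler_sumr -big_split /=.
by apply: eq_bigr => j _; rewrite !mxE scalerA -scalerDl mulrDr mulrCA.
Qed.

HB.instance Definition _ :=
  bilinear_isBilinear.Build F _ _ _ _ _ nf_mul nf_mul_bilinear.

Lemma nf_e_delta (i : 'I_n) : nf_e i.+1 = delta_mx 0 i.
Proof. by apply/rowP=> k; rewrite !mxE eqSS eqxx. Qed.

Lemma nf_e_out (j : nat) : (n < j)%N -> nf_e j = 0.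
Proof.
by move=> ltnj; apply/rowP=> k; rewrite !mxE ltn_eqF // (leq_ltn_trans _ ltnj).
Qed.

Lemma nf_mul_e (p q : nat) : (1 <= p <= n)%N -> (1 <= q <= n)%N ->
  nf_mul (nf_e p) (nf_e q) = nf_table p q.
Proof.
case: p q => [|p] [|q] //= ltpn ltqn; rewrite /nf_mul.
rewrite (bigD1 (Ordinal ltpn)) //= (bigD1 (Ordinal ltqn)) //= !mxE !eqxx.
rewrite mulr1 scale1r !big1 ?addr0 // => i ne_i.
  rewrite big1 // => j _; rewrite !mxE eqSS.
  by rewrite -(inj_eq val_inj) /= in ne_i; rewrite (negPf ne_i) mul0r scale0r.
rewrite !mxE eqSS -(inj_eq val_inj) /= in ne_i *.
by rewrite (negPf ne_i) mulr0 scale0r.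
Qed.

Lemma nf_e_part (j : nat) : (0 < j)%N -> nf_e j \in nf_part (odd j).
Proof.
move=> j_gt0; have [lejn | /nf_e_out ->] := leqP j n; last exact: mem0v.
by apply/memv_span/map_f; rewrite mem_filter eqxx mem_iota j_gt0 add1n ltnS.
Qed.

Lemma nf_partP (b : bool) (x : 'rV[F]_n) :
  reflect (forall i : 'I_n, odd i.+1 != b -> x 0 i = 0) (x \in nf_part b).
Proof.
set s := [seq nf_e j | j <- iota 1 n & odd j == b].
apply: (iffP idP) => [xs i ne_b | x0].
  rewrite (coord_span (X := in_tuple s) xs) summxE big1 // => k _; rewrite mxE.
  have /mapP[j] : s`_k \in s by rewrite mem_nth.
  rewrite mem_filter => /andP[/eqP ob _] ->; rewrite mxE.
  by case: eqP => [e|]; [rewrite e ob eqxx in ne_b | rewrite mulr0].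
rewrite (row_sum_delta x) rpred_sum // => i _.
have [ob | ne_b] := eqVneq (odd i.+1) b; last by rewrite x0 // scale0r mem0v.
by rewrite -nf_e_delta rpredZ // -ob nf_e_part.
Qed.

Lemma nf_part_full : (nf_part false + nf_part true)%VS = fullv.
Proof.
apply/eqP; rewrite eqEsubv subvf; apply/subvP=> x _.
rewrite (row_sum_delta x) rpred_sum // => i _; rewrite rpredZ // -nf_e_delta.
have := @nf_e_part i.+1 isT; case: (odd _); apply/subvP.
  exact: addvSr.
exact: addvSl.
Qed.

Lemma nf_part_direct : (nf_part false :&: nf_part true)%VS = 0%VS.
Proof.
apply/eqP; rewrite -subv0; apply/subvP=> x; rewrite memv_cap memv0.
case/andP=> /nf_partP x0 /nf_partP x1; apply/eqP/rowP=> i; rewrite mxE.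
by have := x0 i; have := x1 i; case: (odd _) => [_ -> | -> ].
Qed.

Lemma nf_table_part (p q : nat) : (0 < p)%N -> (0 < q)%N ->
  nf_table p q \in nf_part (odd p (+) odd q).
Proof.
move=> p_gt0 q_gt0; rewrite /nf_table.
have E k l m : odd (2 * k + 2 * l + m) = odd m by rewrite -mulnDr mul2n oddD odd_double.
case op: (odd p); case oq: (odd q); rewrite /= ?mem0v // rpredZ //.
- by rewrite -[false]/(odd 2) -(E p./2 q./2) nf_e_part // addnS.
- by rewrite -[true]/(odd 1) -(E p./2 q./2) nf_e_part // addnS.
rewrite -[false]/(odd 0) -(E p./2 q./2) addn0 nf_e_part // addn_gt0 muln_gt0.
by case: p p_gt0 op => [|[|p]].
Qed.

Lemma nf_mul_graded (i j : bool) (x y : 'rV[F]_n) :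
  x \in nf_part i -> y \in nf_part j -> nf_mul x y \in nf_part (i (+) j).
Proof.
move=> /nf_partP xi /nf_partP yj; rewrite rpred_sum // => k _.
rewrite rpred_sum // => l _.
have [<- | /xi ->] := eqVneq (odd k.+1) i; last by rewrite mul0r scale0r mem0v.
have [<- | /yj ->] := eqVneq (odd l.+1) j; last by rewrite mulr0 scale0r mem0v.
by rewrite rpredZ // nf_table_part.
Qed.

Definition nf_superalgebra : superalgebra F :=
  @Superalgebra F 'rV[F]_n nf_part nf_mul
    nf_part_full nf_part_direct nf_mul_graded.

End Model.

(* Main.v *)
(* The power Z^2 has codimension one, hence misses some homogeneous x.  The
   Zinbiel identity gives Z^2 Z^k <= Z^(k+2), so Z^k is spanned by Z^(k+1) and
   the power e_k = x(x(...x)) of length k: the powers e_1, ..., e_n form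
   a homogeneous basis.  If x were even, then Z would be even; so x is odd and
   e_k has the parity of k.  Finally
     e_(p+1) e_q = (x e_p) e_q = x (e_p e_q + (-1)^(pq) e_q e_p)
   determines the structure constants by induction on p + q. *)
Require Import Defs.
From mathcomp Require Import all_boot all_order all_algebra.
From mathcomp Require Import sesquilinear zify.
From mathcomp Require Import reals complex.

Set Implicit Arguments.
Unset Strict Implicit.
Unset Printing Implicit Defensive.

Import GRing.Theory.
Local Open Scope ring_scope.

(** * Graded subspaces and products of powers *)

Section Homogeneous.
Variables (F : fieldType) (A : superalgebra F).
Implicit Types U V W T : {vspace A}.

(** The opposite inclusion is automatic. The property serves to lift the Zinbiel identity, stated
    for homogeneous elements, to subspaces. *)
Definition graded U : Prop :=
  (U <= (U :&: part A false) + (U :&: part A true))%VS.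

Lemma graded_fullv : graded fullv.
Proof. by rewrite /graded !capfv part_full. Qed.

Lemma graded_subv U W : graded U ->
  (forall i u, u \in U -> u \in part A i -> u \in W) -> (U <= W)%VS.
Proof.
move=> grU sUW; apply: subv_trans grU _; rewrite subv_add.
by apply/andP; split; apply/subvP=> u; rewrite memv_cap => /andP[]; apply: sUW.
Qed.

Lemma mem_smulv U V u v : u \in U -> v \in V -> smul A u v \in smulv U V.
Proof. by move: u v; apply/smulv_subvP. Qed.

Lemma smulvS U1 U2 V1 V2 :
  (U1 <= U2)%VS -> (V1 <= V2)%VS -> (smulv U1 V1 <= smulv U2 V2)%VS.
Proof.
move=> /subvP sU /subvP sV; apply/smulv_subvP=> u v Uu Vv.
by apply: mem_smulv; auto.
Qed.

Lemma smulv_graded_subv U V W : graded U -> graded V ->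
  (forall i j u v, u \in U -> u \in part A i -> v \in V -> v \in part A j ->
     smul A u v \in W) ->
  (smulv U V <= W)%VS.
Proof.
move=> /subvP grU /subvP grV sUVW; apply/smulv_subvP=> u v.
move=> /grU /memv_addP[u0 + [u1 + ->]] /grV /memv_addP[v0 + [v1 + ->]].
rewrite !memv_cap => /andP[Uu0 Pu0] /andP[Uu1 Pu1] /andP[Vv0 Pv0] /andP[Vv1 Pv1].
rewrite linearDl !linearDr /= !rpredD //.
- exact: sUVW Uu0 Pu0 Vv0 Pv0.
- exact: sUVW Uu0 Pu0 Vv1 Pv1.
- exact: sUVW Uu1 Pu1 Vv0 Pv0.
- exact: sUVW Uu1 Pu1 Vv1 Pv1.
Qed.

Lemma graded_smulv U V : graded U -> graded V -> graded (smulv U V).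
Proof.
move=> grU grV; apply: smulv_graded_subv => // i j u v Uu Pu Vv Pv.
have := smul_graded Pu Pv; have := mem_smulv Uu Vv.
case: (i (+) j) => UVuv Puv; apply: subvP (smul A u v) _.
- exact: addvSr.
- by rewrite memv_cap UVuv.
- exact: addvSl.
- by rewrite memv_cap UVuv.
Qed.

(** The sign depends on the degrees, but a subspace absorbs it. *)
Lemma smulv_zinbiel U V W : zinbiel A -> graded U -> graded V -> graded W ->
  (smulv (smulv U V) W <= smulv U (smulv V W + smulv W V))%VS.
Proof.
move=> zA grU grV grW.
apply: smulv_graded_subv => // [|_ k p w UVp _ Ww Pw]; first exact: graded_smulv.
(* Right multiplication by [w] becomes a linear map, so it suffices to place the products of
   homogeneous [u] and [v] in a preimage. *)
rewrite -[smul A p w]/(applyr (smul A) w p) -(lfunE (applyr (smul A) w)).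
rewrite memv_preim; move: p UVp; apply/subvP/smulv_graded_subv => //.
move=> i j u v Uu Pu Vv Pv; rewrite -memv_preim lfunE /=.
rewrite /applyr /= (zA _ _ _ _ _ _ Pu Pv Pw) mem_smulv // memv_add //.
  exact: mem_smulv.
by rewrite rpredZ // mem_smulv.
Qed.

Lemma spow1 : spow A 1 = fullv. Proof. by []. Qed.

Lemma spowS k : spow A k.+2 = smulv fullv (spow A k.+1). Proof. by []. Qed.

Lemma graded_spow k : graded (spow A k.+1).
Proof.
elim: k => [|k IH]; first exact: graded_fullv.
by rewrite spowS; apply: graded_smulv => //; apply: graded_fullv.
Qed.

(** Powers absorb a left factor by definition. On the right, (Z Z^k) Z lies in Z (Z^k Z + Z Z^k),
    and induction applies. *)
Lemma smulv_spow_full k : zinbiel A -> (smulv (spow A k.+1) fullv <= spow A k.+2)%VS.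
Proof.
move=> zA; elim: k => [|k IH]; first exact: subvv.
apply: subv_trans (smulv_zinbiel zA graded_fullv (graded_spow k) graded_fullv) _.
by apply: smulvS; rewrite ?subvv // subv_add IH -spowS subvv.
Qed.

(** Both inner products Z Z^k and Z^k Z lie in Z^(k+1), hence the gain of two degrees. *)
Lemma smulv_spow2_spow k : zinbiel A ->
  (smulv (spow A 2) (spow A k.+1) <= spow A k.+3)%VS.
Proof.
move=> zA.
apply: subv_trans (smulv_zinbiel zA graded_fullv graded_fullv (graded_spow k)) _.
by apply: smulvS; rewrite ?subvv // subv_add smulv_spow_full // andbT subvv.
Qed.

End Homogeneous.

(** * Left powers of a generator *)

Section LeftPowers.
Variables (F : fieldType) (A : superalgebra F) (x : A).

(* The value at k = 0 is irrelevant. *)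
Definition lpow (k : nat) : A := iter k.-1 (smul A x) x.

Lemma lpowS k : lpow k.+2 = smul A x (lpow k.+1). Proof. by []. Qed.

(** The conjunction is the product of [b] and k+1 in Z/2: the powers of an odd element alternate in
    parity. *)
Lemma lpow_part b k : x \in part A b -> lpow k.+1 \in part A (b && odd k.+1).
Proof.
move=> Px; elim: k => [|k IH]; first by rewrite andbT.
rewrite lpowS; have := smul_graded Px IH.
by rewrite [odd k.+2]/=; case: b {Px IH}; rewrite //= negbK.
Qed.

Lemma lpow_spow k : lpow k.+1 \in spow A k.+1.
Proof.
elim: k => [|k IH]; first by rewrite spow1 memvf.
by rewrite lpowS spowS mem_smulv ?memvf.
Qed.

(** Expand Z Z^k with Z = <x> + Z^2 and Z^k = <e_k> + Z^(k+1): modulo Z^(k+2) only the multiples of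
    x e_k = e_(k+1) survive. *)
Lemma spow_lpow k : zinbiel A -> (<[x]> + spow A 2 = fullv)%VS ->
  spow A k.+1 = (<[lpow k.+1]> + spow A k.+2)%VS.
Proof.
move=> zA genA; elim: k => [|k IH]; first by rewrite spow1 -genA.
apply/eqP; rewrite eqEsubv; apply/andP; split; last first.
  rewrite subv_add -memvE lpow_spow /=.
  have sS : (spow A k.+2 <= spow A k.+1)%VS by rewrite IH addvSr.
  exact: smulvS (subvv _) sS.
rewrite {1}spowS; apply/smulv_subvP => u v; rewrite -genA => uU vV.
have sS v' : v' \in spow A k.+2 -> smul A u v' \in spow A k.+3.
  by move=> Vv'; rewrite spowS mem_smulv ?memvf.
have /memv_addP[_ /vlineP[b ->] [t St vE]] :
  v \in (<[lpow k.+1]> + spow A k.+2)%VS by rewrite -IH.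
rewrite vE linearDr rpredD //=; last first.
  by apply: subvP (sS _ St); apply: addvSr.
have /memv_addP[_ /vlineP[a ->] [s Ss ->]] := uU.
rewrite linearZr_LR rpredZ //= linearDl linearZl_LR /= memv_add //.
  by rewrite rpredZ // memv_line.
apply: subvP (mem_smulv Ss (lpow_spow k)).
exact: smulv_spow2_spow.
Qed.

Lemma lpow_basis n : zinbiel A -> null_filiform n A ->
  (<[x]> + spow A 2 = fullv)%VS ->
  basis_of fullv [seq lpow j | j <- iota 1 n].
Proof.
move=> zA [dimA dimS] genA.
rewrite basisEdim size_map size_iota dimA leqnn andbT.
(* One power is peeled off at a time. At m = n the remainder Z^(n+1) has dimension 0, and n spanning
   vectors in dimension n form a basis. *)
have spanE m :
    (spow A 1 <= <<[seq lpow j | j <- iota 1 m]>> + spow A m.+1)%VS.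
  elim: m => [|m IH]; first exact: addvSr.
  rewrite -[in iota 1 _](addn1 m) iotaD map_cat span_cat add1n span_seq1.
  by rewrite -addvA -spow_lpow // IH.
have := spanE n; have /eqP := dimS n.+1 (leqnn _).
by rewrite subnn dimv_eq0 => /eqP ->; rewrite addv0.
Qed.

Lemma lpow_out n k : zinbiel A -> null_filiform n A -> (n < k)%N -> lpow k = 0.
Proof.
move=> zA [_ dimS] ltnk; case: k ltnk => // k lenk; apply/eqP.
rewrite -memv0; suff <- : spow A k.+1 = 0%VS by apply: lpow_spow.
(* The dimensions are prescribed only up to Z^(n+1) = 0; later powers vanish inductively. *)
rewrite -(subnKC lenk); elim: (k.+1 - n.+1)%N => [|m IH].
  apply/eqP; rewrite addn0 -dimv_eq0 dimS ?subnn //=.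
rewrite addnS spowS -addSn IH.
apply/eqP; rewrite -subv0; apply/smulv_subvP=> u v _.
by rewrite memv0 => /eqP ->; rewrite linear0r mem0v.
Qed.

End LeftPowers.

(** * Binomial structure constants *)

Definition nf_coef (p q : nat) : nat :=
  let k := p./2 in
  let l := q./2 in
  match odd p, odd q with
  | true, false => 'C(k + l, k)
  | false, false => 'C(k + l - 1, l)
  | true, true => 'C(k + l, l)
  | false, true => 0
  end.

Lemma nf_tableE (F : fieldType) (n p q : nat) :
  nf_table F n p q = (nf_coef p q)%:R *: nf_e F n (p + q).
Proof.
rewrite /nf_table /nf_coef; move: (odd_double_half p) (odd_double_half q).
case: (odd p); case: (odd q) => /= pE qE; rewrite ?scale0r //.
all: by congr (_ *: nf_e _ _ _); lia.
Qed.

Lemma nf_coef1 (q : nat) : (0 < q)%N -> nf_coef 1 q = 1%N.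
Proof. by rewrite /nf_coef /= add0n bin0 binn; case: odd. Qed.

(** This is the recurrence that the Zinbiel identity imposes. For [p], [q] both even it is Pascal's
    rule; for both odd the two terms cancel; in mixed parity one term vanishes, leaving at most the
    symmetry of binomials. *)
Lemma nf_coefS (F : fieldType) (p q : nat) : (0 < p)%N -> (0 < q)%N ->
  (nf_coef p.+1 q)%:R =
  (nf_coef p q)%:R + (-1) ^+ (odd p && odd q) * (nf_coef q p)%:R :> F.
Proof.
rewrite -(odd_double_half p) -(odd_double_half q).
move: (odd p) (odd q) p./2 q./2 => b c k l.
have -> : (b + k.*2).+1 = (~~ b + (k + b).*2)%N by case: b => /=; lia.
have binC i j : 'C(i + j, i) = 'C(i + j, j).
  by rewrite -bin_sub ?leq_addr // addKn.
rewrite /nf_coef !oddD !odd_double !half_bit_double !oddb !addbF [(l + k)%N]addnC.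
case: b c => [] [] /= k_gt0 l_gt0; rewrite ?addn0 ?expr1 ?expr0 ?mul1r ?mulN1r.
- by rewrite binC subrr.
- by rewrite addr0 addn1 addSn subn1 binC.
- by rewrite add0r.
rewrite -natrD; case: l l_gt0 => // l _; case: k k_gt0 => // k _.
by rewrite addSn subn1 /= binS (binC k l.+1) addnC.
Qed.

Lemma count_odd_iota (b : bool) n :
  count (fun j => odd j == b) (iota 1 n) = if b then uphalf n else n./2.
Proof.
elim: n => [|n IH]; first by case: b.
rewrite -[in iota 1 _](addn1 n) iotaD count_cat IH /= addn0 add0n uphalf_half.
by case: b {IH}; case: (odd n) => /=; lia.
Qed.

(** * Multiplication table for an odd generator *)

Section OddGenerator.
Variables (F : fieldType) (A : superalgebra F) (x : A) (n : nat).
Hypotheses (zA : zinbiel A) (Px : x \in part A true).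

(** The identity also produces the swapped product e_q e_p, so the induction is on p + q. *)
Lemma lpow_mul p q : (0 < p)%N -> (0 < q)%N ->
  smul A (lpow x p) (lpow x q) = (nf_coef p q)%:R *: lpow x (p + q).
Proof.
have [m] := ubnP (p + q); elim: m p q => // m IH [|[|p]] // [|q] // le_m _ _.
  by rewrite nf_coef1 // scale1r.
rewrite lpowS (zA Px (lpow_part p Px) (lpow_part q Px)).
rewrite !IH //; try by move: le_m; lia.
rewrite scalerA [(q.+1 + _)%N]addnC -scalerDl -nf_coefS // linearZr_LR /=.
by rewrite !addSn -lpowS.
Qed.


Hypotheses (nfA : null_filiform n A) (genA : (<[x]> + spow A 2 = fullv)%VS).

Let E := [seq lpow x j | j <- iota 1 n].

Let basisE : basis_of fullv E. Proof. exact: lpow_basis. Qed.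

Let freeE : free E. Proof. exact: basis_free basisE. Qed.

(** Each span lies in its part and the two spans fill the space; as the parts meet in 0, the
    inclusions are equalities. *)
Lemma part_lpow b :
  part A b = <<[seq lpow x j | j <- iota 1 n & odd j == b]>>%VS.
Proof.
set U := fun b => <<[seq lpow x j | j <- iota 1 n & odd j == b]>>%VS.
have sUP c : (U c <= part A c)%VS.
  apply/span_subvP=> u /mapP[j + ->]; rewrite mem_filter mem_iota.
  by case: j => [|j] /andP[/eqP <- //]; rewrite -[odd _]andTb => _; apply: lpow_part.
have fullU : (U b + U (~~ b))%VS = fullv.
  apply/eqP; rewrite eqEsubv subvf -(span_basis basisE).
  apply/span_subvP=> u /mapP[j nj ->]; have [oj | /negPf oj] := eqVneq (odd j) b.
    apply: subvP (addvSl _ _) _ _; apply/memv_span/map_f.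
    by rewrite mem_filter oj eqxx.
  apply: subvP (addvSr _ _) _ _; apply/memv_span/map_f.
  by rewrite mem_filter nj andbT; move: oj; case: (odd j) b => [] [].
apply/eqP; rewrite eqEsubv sUP andbT; apply/subvP=> u Pu.
have /memv_addP[v Uv [w Uw uE]] : u \in (U b + U (~~ b))%VS.
  by rewrite fullU memvf.
suff w0 : w = 0 by rewrite uE w0 addr0.
apply/eqP; rewrite -memv0 -(part_direct A) memv_cap.
have Pw : w \in part A b.
  have -> : w = u - v by rewrite uE addrC addKr.
  by rewrite rpredB // (subvP (sUP b)).
have := subvP (sUP _) _ Uw.
by case: b Pw {Pu sUP fullU Uv Uw} => /= -> ->.
Qed.

Lemma dim_part b : \dim (part A b) = count (fun j => odd j == b) (iota 1 n).
Proof.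
rewrite part_lpow -size_filter -(size_map (lpow x)); apply/eqP.
(* The selected powers followed by the others permute the free family [E]. *)
apply: (@catl_free _ _ [seq lpow x j | j <- iota 1 n & odd j != b]).
rewrite -map_cat (_ : free _ = free E) //; apply/perm_free/perm_map.
by rewrite perm_filterC.
Qed.

Lemma lpow_superisomorphic : superisomorphic A (nf_superalgebra F n).
Proof.
pose E' := [seq nf_e F n j | j <- iota 1 n].
have [f fE] := linear_of_free E E'.
(* Both sides vanish for j > n, so this also covers the index p + q of a product. *)
have {fE} fe j : (0 < j)%N -> f (lpow x j) = nf_e F n j.
  move=> j_gt0; have [lejn | ltnj] := leqP j n; last first.
    by rewrite (lpow_out x zA nfA ltnj) nf_e_out // linear0.
  have := fE freeE; rewrite !size_map -map_comp => /(_ erefl)/eq_in_map.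
  by apply; rewrite mem_iota j_gt0 add1n ltnS.
have f_part b : (linfun f @: part A b)%VS = nf_part F n b.
  rewrite part_lpow limg_span -map_comp; congr <<_>>%VS.
  apply/eq_in_map=> j; rewrite mem_filter mem_iota => /and3P[_ j_gt0 _] /=.
  by rewrite lfunE /= fe.
(* Surjectivity comes from the parts, then injectivity from equal dimensions. *)
have f_full : limg (linfun f) = fullv.
  by rewrite -(part_full A) limgD !f_part nf_part_full.
have f_ker : lker (linfun f) == 0%VS.
  have [dimA _] := nfA; have := limg_ker_dim (linfun f) fullv.
  rewrite f_full dimA dimvf /dim /= mul1n capfv -[RHS]add0n => /addIn/eqP.
  by rewrite dimv_eq0.
exists (linfun f); split=> //.
  exists (linfun f)^-1%VF; first exact: lker0_lfunK.
  by move=> w; rewrite limg_lfunVK // f_full memvf.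
have nthE (i : 'I_(size E)) : (i < n)%N /\ E`_i = lpow x i.+1.
  have ltin : (i < n)%N.
    by rewrite (leq_trans (ltn_ord i)) // size_map size_iota.
  split=> //.
  by rewrite (nth_map 0%N) ?size_iota // nth_iota.
move=> u v; rewrite !lfunE /=.
rewrite (coord_basis (X := in_tuple E) basisE (memvf u)).
rewrite (coord_basis (X := in_tuple E) basisE (memvf v)).
rewrite !(linear_sumlz, linear_sum) /=; apply: eq_bigr => i _.
rewrite !linear_sumr linear_sum; apply: eq_bigr => j _.
rewrite linearZl_LR linearZr_LR !(linearZ_LR f) linearZl_LR linearZr_LR /=.
congr (_ *: (_ *: _)).
have [[ltin ->] [ltjn ->]] := (nthE i, nthE j).
rewrite lpow_mul // linearZ_LR !fe ?addSn // -nf_tableE.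
by rewrite -(nf_mul_e F) ?ltin ?ltjn.
Qed.

End OddGenerator.

(** * Existence of an odd generator *)

Lemma null_filiform_generator (F : fieldType) (A : superalgebra F) n :
  null_filiform n A -> (0 < n)%N ->
  exists b x, x \in part A b /\ (<[x]> + spow A 2)%VS = fullv.
Proof.
move=> [dimA dimS] n_gt0.
have dim2 : \dim (spow A 2) = n.-1 by rewrite dimS // subSS subn1.
(* If both parts lay in Z^2, so would Z, of dimension n > n - 1. *)
have [b nsP] : exists b, ~~ (part A b <= spow A 2)%VS.
  case sP0: (part A false <= spow A 2)%VS; last by exists false; rewrite sP0.
  case sP1: (part A true <= spow A 2)%VS; last by exists true; rewrite sP1.
  have : (part A false + part A true <= spow A 2)%VS by rewrite subv_add sP0.
  by rewrite part_full => /dimvS; rewrite dimA dim2 -ltnS prednK ?ltnn.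
have [x Px nSx] := subvPn nsP; exists b, x; split=> //.
apply/eqP; rewrite eqEdim subvf dimA -[leqLHS](prednK n_gt0) -dim2.
by rewrite (ltn_leqif (dimv_leqif_sup (addvSr _ _))) subv_add subvv andbT -memvE.
Qed.

Lemma null_filiform_odd_generator (F : fieldType) (A : superalgebra F) n :
  zinbiel A -> null_filiform n A -> part A true != 0%VS ->
  exists2 x, x \in part A true & (<[x]> + spow A 2)%VS = fullv.
Proof.
move=> zA nfA P1n0; have [dimA _] := nfA.
have n_gt0 : (0 < n)%N.
  by rewrite -dimA (leq_trans _ (dimvS (subvf (part A true)))) // lt0n dimv_eq0.
have [[] [x [Px genA]]] := null_filiform_generator nfA n_gt0; first by exists x.
(* Here [x] is even, hence so are all its powers; they span Z, so the odd part is zero. *)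
case/eqP: P1n0; apply/eqP; rewrite -subv0 -(part_direct A) subv_cap subvv andbT.
apply: subv_trans (subvf _) _; rewrite -(span_basis (lpow_basis zA nfA genA)).
apply/span_subvP=> u /mapP[[|j]]; rewrite mem_iota // => _ ->.
exact: (lpow_part j Px).
Qed.

Local Close Scope ring_scope.

Theorem theorem14 (R : realType) (n : nat) (Z : superalgebra R[i]) :
  zinbiel Z -> null_filiform n Z -> \dim (part Z true) <> 0 ->
  (\dim (part Z false) = \dim (part Z true) \/
   \dim (part Z true) = \dim (part Z false) + 1) /\
  superisomorphic Z (nf_superalgebra R[i] n).
Proof.
move=> zZ nfZ /eqP; rewrite dimv_eq0 => P1n0.
have [x Px genZ] := null_filiform_odd_generator zZ nfZ P1n0.
split; last exact: lpow_superisomorphic zZ Px nfZ genZ.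
rewrite !(dim_part zZ Px nfZ genZ).
(* For odd n the odd indices in 1, ..., n outnumber the even ones by one; for even n they are
   equally many. *)
rewrite !count_odd_iota /= uphalf_half; case: odd; [right|left]; lia.
Qed.
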